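(* Let $n\ge 3$ be an integer and let $H(n,1)$ be the bipartite Kneser graph. Then $\mathrm{Aut}(H(n,1))\cong \mathrm{Sym}([n])\times \mathbb{Z}_2$.
   Context: Let $[n]=\{1,2,\dots,n\}$. For $n\ge 3$, the bipartite Kneser graph $H(n,1)$ is the simple graph whose vertices are all the $1$-element subsets and all the $(n-1)$-element subsets of $[n]$, two distinct vertices $A,B$ being adjacent if and only if $A\subset B$ or $B\subset A$. $\mathrm{Aut}(\Gamma)$ denotes the automorphism group of a graph $\Gamma$, $\mathrm{Sym}([n])$ the symmetric group on $[n]$, and $\mathbb{Z}_2$ the cyclic group of order $2$. *)

(* Defs.v *)
From mathcomp Require Import all_boot all_fingroup all_algebra.
Set Implicit Arguments.
Unset Strict Implicit.
Unset Printing Implicit Defensive.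
Local Open Scope group_scope.

Definition graph_aut (V : finType) (e : rel V) : {set {perm V}} :=
  [set s : {perm V} | [forall x, forall y, e (s x) (s y) == e x y]].

Lemma graph_aut_group_set (V : finType) (e : rel V) :
  group_set (graph_aut e).
Proof.
apply/group_setP; split=> [|s t].
  by rewrite inE; apply/'forall_forallP=> x y; rewrite !perm1.
rewrite !inE => /'forall_forallP es /'forall_forallP et.
by apply/'forall_forallP=> x y; rewrite !permM (eqP (et _ _)) (eqP (es _ _)).
Qed.

Canonical graph_aut_group (V : finType) (e : rel V) :=
  Group (graph_aut_group_set e).

(* The ground set [n] is represented by 'I_n = {0, ..., n-1}. *)
Definition bikneser1_vertex (n : nat) : finType :=
  {A : {set 'I_n} | (#|A| == 1%N) || (#|A| == n.-1)}.

Definition bikneser1_adj (n : nat) : rel (bikneser1_vertex n) :=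
  fun A B => (A != B) && ((val A \subset val B) || (val B \subset val A)).

(* Main.v *)
Require Import Defs.
From mathcomp Require Import all_boot all_fingroup all_algebra.
Set Implicit Arguments.
Unset Strict Implicit.
Unset Printing Implicit Defensive.
Local Open Scope group_scope.

(** The graph H(n,1) is a crown graph: label the singleton of i by (1, i) and
    its complement by (b, i), with b the nontrivial element of Z_2. A singleton
    {i} lies in the complement of {j} exactly when i differs from j, and two
    distinct sets of the same size are never nested, so two labels are adjacent
    if and only if they differ in both coordinates ([label_vertex_mono]). It
    remains to find the automorphisms of this crown graph on Z_2 x T, #|T| > 2.

    The group Sym(T) x Z_2 acts on the labels coordinatewise, faithfully and by
    automorphisms. Conversely, an automorphism g respects two relations that
    can be read off from adjacency. Because T has a third element besides any
    given two, two vertices are on the same side if and only if they have a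
    common neighbour ([crown_same_side]); hence g acts on sides by a
    translation of Z_2. On opposite sides, non-adjacency means having equal
    second coordinates; hence g acts on second coordinates by a map that does
    not depend on the side, and this map is a permutation. So g comes from
    Sym(T) x Z_2 ([crown_aut_coord]). *)

(** * Transport of automorphism groups *)

Lemma graph_autP (V : finType) (e : rel V) (s : {perm V}) :
  reflect {mono s : x y / e x y} (s \in graph_aut e).
Proof.
rewrite inE; apply: (iffP 'forall_forallP) => [es x y|es x y].
  exact/eqP/es.
by rewrite es.
Qed.

Section Transport.

Variables (V W : finType) (f : W -> V) (g : V -> W).
Hypotheses (fK : cancel f g) (gK : cancel g f).

Lemma conj_perm_inj (s : {perm W}) : injective (fun v => f (s (g v))).
Proof.
by move=> u v /(can_inj fK) /perm_inj /(can_inj gK).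
Qed.

Definition conj_perm (s : {perm W}) : {perm V} := perm (@conj_perm_inj s).

Lemma conj_permM : {in [set: {perm W}] &, {morph conj_perm : s t / s * t}}.
Proof. by move=> s t _ _; apply/permP=> v; rewrite !(permE, permM) /= fK. Qed.

Canonical conj_perm_morphism := Morphism conj_permM.

End Transport.

Lemma graph_aut_isog (V W : finType) (e : rel V) (e' : rel W) (f : W -> V) :
  bijective f -> {mono f : x y / e' x y >-> e x y} ->
  graph_aut e' \isog graph_aut e.
Proof.
case=> g fK gK fe; pose h := conj_perm_morphism fK gK.
have hE s v : h s v = f (s (g v)) by rewrite permE.
have sub : graph_aut e' \subset [set: {perm W}] by apply: subsetT.
apply/isogP; exists (restrm sub h).
  apply/injmP=> s t _ _ st; apply/permP=> w; apply: (can_inj fK).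
  by move/permP/(_ (f w)): st; rewrite /= !permE fK.
rewrite im_restrm; apply/setP=> s; apply/morphimP/graph_autP => [[t _ et ->]|es].
  by move=> x y; rewrite !hE fe (graph_autP _ _ et) -fe !gK.
exists (conj_perm gK fK s); rewrite ?inE //; last first.
  by apply/permP=> v; rewrite hE permE !gK.
by apply/'forall_forallP=> x y; rewrite !permE -fe !gK es fe.
Qed.

(** * Automorphisms of crown graphs *)

Definition crown (T : finType) : rel ('Z_2 * T) :=
  fun x y => (x.1 != y.1) && (x.2 != y.2).

Lemma Z2_eq_of_neq (a b c : 'Z_2) : a != c -> b != c -> a = b.
Proof.
by move: a b c => [[|[|//]] ?] [[|[|//]] ?] [[|[|//]] ?] // _ _; apply: val_inj.
Qed.

Lemma Z2_exists_neq (a : 'Z_2) : exists b : 'Z_2, b != a.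
Proof.
by have [->|a0] := eqVneq a 0%R; [exists 1%R | exists 0%R; rewrite eq_sym].
Qed.

Section CrownAction.

Variable T : finType.
Implicit Types (p : {perm T} * 'Z_2) (x y : 'Z_2 * T).

Lemma crown_act_inj p : injective (fun x => (x.1 * p.2, p.1 x.2)).
Proof.
move=> [a i] [b j] /eqP; rewrite xpair_eqE (inj_eq (mulIg _)) (inj_eq perm_inj).
by rewrite -xpair_eqE => /eqP.
Qed.

Definition crown_act p : {perm 'Z_2 * T} := perm (@crown_act_inj p).

Lemma crown_actM :
  {in [set: {perm T} * 'Z_2] &, {morph crown_act : p q / p * q}}.
Proof.
by move=> p q _ _; apply/permP=> x; rewrite permM !permE /= mulgA.
Qed.

Canonical crown_act_morphism := Morphism crown_actM.

Lemma crown_act_aut p : crown_act p \in graph_aut (@crown T).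
Proof.
apply/graph_autP=> x y; rewrite !permE /crown /=.
by rewrite (inj_eq (mulIg _)) (inj_eq perm_inj).
Qed.

(** Neighbours lie on the opposite side, and there are only two sides, so a
    common neighbour forces equal sides. Conversely any point on the other side
    whose second coordinate avoids both x.2 and y.2 is a common neighbour; such
    a point may fail to exist when #|T| = 2. *)
Lemma crown_same_side x y : 2 < #|T| ->
  (x.1 == y.1) = [exists z, crown x z && crown y z].
Proof.
move=> T3; apply/eqP/existsP => [xy|[z /andP[/andP[xz _] /andP[yz _]]]]; last first.
  exact: Z2_eq_of_neq xz yz.
have [k] : exists k, k \in ~: [set x.2; y.2].
  apply/set0Pn; rewrite -card_gt0 cardsCs setCK subn_gt0.
  by apply: leq_ltn_trans T3; rewrite cards2; case: (_ == _).
rewrite !inE negb_or => /andP[kx ky]; have [b bx] := Z2_exists_neq x.1.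
exists (b, k); rewrite /crown /= -xy.
by rewrite !(eq_sym _ b) bx !(eq_sym _ k) kx ky.
Qed.

Variable g : {perm 'Z_2 * T}.
Hypotheses (T3 : 2 < #|T|) (g_aut : g \in graph_aut (@crown T)).

Lemma crown_aut_side x y : ((g x).1 == (g y).1) = (x.1 == y.1).
Proof.
rewrite !crown_same_side //; apply/existsP/existsP=> [][z].
  by rewrite -(permKV g z) !(graph_autP _ _ g_aut); exists (g^-1 z).
by exists (g z); rewrite !(graph_autP _ _ g_aut).
Qed.

(** For opposite sides, equality of second coordinates is non-adjacency. *)
Lemma crown_aut_antipode x y :
  x.1 != y.1 -> ((g x).2 == (g y).2) = (x.2 == y.2).
Proof.
move=> xy; have := graph_autP _ _ g_aut x y.
by rewrite /crown crown_aut_side xy /= => /negb_inj.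
Qed.

(** Reading g on side 1 gives the permutation s of T and the translation of
    Z_2; comparing any other point with the one of side 1 having the same
    second coordinate shows that these determine g everywhere. *)
Lemma crown_aut_coord : exists p, g = crown_act p.
Proof.
pose s i := (g (1, i)).2.
have gs b i : (g (b, i)).2 = s i.
  have [->//|b1] := eqVneq b 1.
  by apply/eqP; rewrite crown_aut_antipode.
have s_inj : injective s.
  move=> i j sij; suff /perm_inj[] : g (1, i) = g (1, j) by [].
  have /eqP g1 : (g (1, i)).1 == (g (1, j)).1 by rewrite crown_aut_side.
  by rewrite [LHS]surjective_pairing g1 -/(s i) sij -surjective_pairing.
have [i0 _] : exists i0 : T, i0 \in T.
  by apply/card_gt0P; apply: leq_trans T3.
exists (perm s_inj, (g (1, i0)).1); apply/permP=> [[b i]].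
rewrite permE /= permE -(gs b i) [LHS]surjective_pairing; congr (_, _).
have [->|b1] := eqVneq b 1.
  by rewrite mul1g; apply/eqP; rewrite crown_aut_side.
(* Both sides differ from the image of side 1, hence agree. *)
apply: (@Z2_eq_of_neq _ _ (g (1, i0)).1); first by rewrite crown_aut_side.
by rewrite -{2}(mul1g (g (1, i0)).1) (inj_eq (mulIg _)).
Qed.

End CrownAction.

Lemma crown_aut_isog (T : finType) : 2 < #|T| ->
  graph_aut (@crown T) \isog [set: {perm T} * 'Z_2].
Proof.
move=> T3; rewrite isog_sym; apply/isogP; exists (crown_act_morphism T).
  have [i0 _] : exists i0 : T, i0 \in T.
    by apply/card_gt0P; apply: leq_trans T3.
  apply/injmP=> -[s a] [t b] _ _ /= /permP st; congr (_, _).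
    by apply/permP=> i; have := congr1 snd (st (1, i)); rewrite !permE.
  by have := congr1 fst (st (1, i0)); rewrite !permE /= !mul1g.
apply/setP=> g; apply/morphimP/idP => [[p _ _ ->]|/crown_aut_coord[]// p ->].
  exact: crown_act_aut.
by exists p; rewrite ?inE.
Qed.

(** * The graph H(n,1) is a crown graph *)

Definition label_set n (x : 'Z_2 * 'I_n) : {set 'I_n} :=
  if x.1 == 1 then [set x.2] else ~: [set x.2].

Lemma label_set_card n (x : 'Z_2 * 'I_n) :
  (#|label_set x| == 1%N) || (#|label_set x| == n.-1).
Proof.
rewrite /label_set; case: ifP => _; first by rewrite cards1.
by rewrite cardsC1 card_ord eqxx orbT.
Qed.

Definition label_vertex n (x : 'Z_2 * 'I_n) : bikneser1_vertex n :=
  exist _ (label_set x) (label_set_card x).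

(** For n > 2 a set of size n-1 cannot lie in a singleton, so the only
    inclusions between the two sides go from singletons to complements. *)
Lemma label_set_sub n (x y : 'Z_2 * 'I_n) : 2 < n ->
  (label_set x \subset label_set y) =
  (if x.1 == y.1 then x.2 == y.2 else (x.1 == 1) && (x.2 != y.2)).
Proof.
move=> n3; case: x y => [a i] [b j]; rewrite /label_set /=.
have [->|a1] := eqVneq a 1; have [b1|b1] := eqVneq b 1.
- by rewrite sub1set inE.
- by rewrite sub1set !inE.
- rewrite b1 (negPf a1) /=; apply/negP=> /subset_leq_card.
  by rewrite cardsC1 cards1 card_ord; case: n n3 {i j} => [|[|[]]].
- by rewrite (Z2_eq_of_neq a1 b1) eqxx setCS sub1set inE eq_sym.
Qed.

Lemma label_vertex_inj n : 2 < n -> injective (@label_vertex n).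
Proof.
move=> n3 x y /(congr1 val) /= xy.
have := label_set_sub x y n3; have := label_set_sub y x n3.
rewrite xy subxx (eq_sym y.1) (eq_sym y.2).
case: x y {xy} => [a i] [b j] /=; have [->|ab] := eqVneq a b.
  by move=> /esym/eqP->.
move=> /esym/andP[/eqP b1 _] /esym/andP[/eqP a1 _].
by rewrite a1 b1 eqxx in ab.
Qed.

Lemma label_vertex_surj n (v : bikneser1_vertex n) : 2 < n ->
  exists x, label_vertex x == v.
Proof.
case: v => A cardA n3; case/orP: (cardA) => [/cards1P[i Ai]|/eqP An].
  by exists (1, i); rewrite -val_eqE /= /label_set eqxx Ai.
have /cards1P[i Ai] : #|~: A| == 1%N.
  by rewrite cardsCs setCK card_ord An; case: n n3 {A cardA An} => // n _; rewrite subSnn.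
have [b b1] := Z2_exists_neq 1.
by exists (b, i); rewrite -val_eqE /= /label_set (negPf b1) -Ai setCK.
Qed.

Lemma label_vertex_bij n : 2 < n -> bijective (@label_vertex n).
Proof.
move=> n3; pose g v := xchoose (label_vertex_surj v n3).
have gK : cancel g (@label_vertex n).
  by move=> v; apply/eqP/(xchooseP (label_vertex_surj v n3)).
by exists g => // x; apply: (label_vertex_inj n3); rewrite gK.
Qed.

Lemma label_vertex_mono n : 2 < n ->
  {mono @label_vertex n : x y / crown x y >-> bikneser1_adj x y}.
Proof.
move=> n3 x y; rewrite /bikneser1_adj (inj_eq (label_vertex_inj n3)) /=.
rewrite !label_set_sub // (eq_sym y.1) (eq_sym y.2) /crown.
case: x y => [a i] [b j] /=; rewrite xpair_eqE.
have [_|ab] := eqVneq a b; first by case: (i == j).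
(* Exactly one of the two distinct sides is the side of singletons. *)
have -> /= : (a == 1) && (i != j) || (b == 1) && (i != j) = (i != j).
  rewrite -andb_orl; have [//|a1] := eqVneq a 1; have [//|b1] := eqVneq b 1.
  by rewrite (Z2_eq_of_neq a1 b1) eqxx in ab.
by [].
Qed.

Theorem theorem3p6 (n : nat) (hn : (3 <= n)%N) :
  graph_aut (@bikneser1_adj n) \isog [set: {perm 'I_n} * 'Z_2].
Proof.
have iso := graph_aut_isog (label_vertex_bij hn) (label_vertex_mono hn).
rewrite isog_sym in iso; apply: isog_trans iso _.
by apply: crown_aut_isog; rewrite card_ord.
Qed.
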